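(* Consider the sensing model described in the context with a fixed number $K_s\ge1$ of targets, fixed spatial frequencies $\boldsymbol\omega=[\omega_1,\dots,\omega_{K_s}]^T$ (nondegenerate, in the sense of the context, for both arrays if $K_s\ge2$), fixed nonzero reflection coefficients and fixed noise variance $\sigma_r^2>0$. Consider a co-prime array (CPA) with $M_s$ sensing elements and a partitioned uniform linear array (ULA) having the same physical sensing aperture as the CPA. Let the transmit power of each sensing transmit antenna be kept fixed, with full-rank and uniformly well-conditioned sensing transmit covariances. Let $L_{\mathrm{CPA}}$ and $L_{\mathrm{ULA}}$ denote the numbers of snapshots used by the CPA and by the same-aperture ULA, respectively, when the two attain the same spatial-frequency CRB, i.e. $$\operatorname{tr}(\mathbf{CRB}_{\boldsymbol\omega,\mathrm{CPA}})=\operatorname{tr}(\mathbf{CRB}_{\boldsymbol\omega,\mathrm{ULA}}).$$ Then, for all sufficiently large $M_s$, the CPA requires more snapshots than the ULA: $$L_{\mathrm{CPA}}>L_{\mathrm{ULA}}.$$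
   Context: Arrays. A target at angle $\theta_m$ has spatial frequency $\omega_m=\pi\sin\theta_m$; the element grid has unit spacing $d$ (half a wavelength); $j=\sqrt{-1}$. - CPA: generated by co-prime positive integers $(M_1,M_2)$ with $M_s=M_1+M_2-1$, $M_1=\rho(M_s+1)$, $M_2=(1-\rho)(M_s+1)$, where $\rho\in(0,1)$ may depend on $M_s$ but stays in a fixed compact subinterval $I\subset(0,1)$; $M_s\to\infty$ along an infinite family of such pairs. Transmit elements are at $mM_2d$, $m=0,\dots,M_1-1$, and receive elements at $nM_1d$, $n=0,\dots,M_2-1$, with steering vectors $\mathbf a_t(\omega)=[1,e^{jM_2\omega},\dots,e^{j(M_1-1)M_2\omega}]^T$ and $\mathbf a_r(\omega)=[1,e^{jM_1\omega},\dots,e^{j(M_2-1)M_1\omega}]^T$. Its physical aperture, determined by the outermost element, is $A_{\mathrm{CPA}}=\max\{(M_1-1)M_2,(M_2-1)M_1\}\,d$. - Same-aperture partitioned ULA: it has $M_{\mathrm U}$ sensing elements, and its physical aperture is $A_{\mathrm{ULA}}=(M_{\mathrm U}-1)d$, with $A_{\mathrm{ULA}}=A_{\mathrm{CPA}}$. It has $N_1$ transmit and $N_2$ receive elements with $N_1+N_2-1=M_{\mathrm U}$ and $N_1/(M_{\mathrm U}+1)$ in a fixed compact subinterval of $(0,1)$, and steering vectors $\mathbf a_t(\omega)=[1,e^{j\omega},\dots,e^{j(N_1-1)\omega}]^T$, $\mathbf a_r(\omega)=[1,e^{j\omega},\dots,e^{j(N_2-1)\omega}]^T$. For each array, write $N_t,N_r$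 for its numbers of transmit and receive elements. The virtual manifold is $\boldsymbol\phi(\omega)=\mathbf a_t^*(\omega)\otimes\mathbf a_r^*(\omega)$, where $^*$ is the entrywise complex conjugate and $\otimes$ the Kronecker product. Nondegenerate placement ($K_s\ge2$). There is a constant $\delta\in(0,1)$, independent of $M_s$, such that for all $m\neq n$: $|\sin(M_1(\omega_m-\omega_n)/2)|\ge\delta$ and $|\sin(M_2(\omega_m-\omega_n)/2)|\ge\delta$ (CPA), and $|\sin((\omega_m-\omega_n)/2)|\ge\delta$ (ULA). Fisher information and CRB. For an array using $L$ snapshots with transmit covariance $\mathbf R_s\in\mathbb C^{N_t\times N_t}$, the vectorized observation is $(\mathbf X^T\otimes\mathbf I_{N_r})\sum_{m}\beta_m\boldsymbol\phi(\omega_m)$ plus circularly symmetric complex Gaussian noise with covariance $\sigma_r^2\mathbf I$, where $\frac1L\mathbf X\mathbf X^H$ is identified with $\mathbf R_s$. The real unknown parameters are $\boldsymbol\xi=[\boldsymbol\omega^T,\boldsymbol\eta^T]^T$, $\boldsymbol\eta=[\operatorname{Re}\boldsymbol\beta^T,\operatorname{Im}\boldsymbol\beta^T]^T$. With $\boldsymbol\psi(\boldsymbol\xi)=\sum_m\beta_m\boldsymbol\phi(\omega_m)$, $$[\mathbf F]_{i,k}=\frac{2L}{\sigma_r^2}\operatorname{Re}\Big\{\Big(\frac{\partial\boldsymbol\psi}{\partial\xi_i}\Big)^H(\mathbf R_s^T\otimes\mathbf I_{N_r})\frac{\partial\boldsymbol\psi}{\partial\xi_k}\Big\},\qquad \mathbf{CRB}_{\boldsymbol\omega}=\big(\mathbf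 F_{\omega\omega}-\mathbf F_{\omega\eta}\mathbf F_{\eta\eta}^{-1}\mathbf F_{\eta\omega}\big)^{-1}.$$ For $K_s=1$ the trace is just the scalar CRB. The numbers of snapshots $L_{\mathrm{CPA}},L_{\mathrm{ULA}}>0$ (positive numbers, possibly depending on $M_s$) are the values of $L$ used for the respective array. Power assumption. For both arrays every diagonal entry of the Hermitian positive definite matrix $\mathbf R_s$ equals the same constant $p>0$, independent of $M_s$; ''uniformly well-conditioned'' means that there are constants $0<c_1\le c_2$ independent of $M_s$ such that all eigenvalues of $\mathbf R_s$ (for both arrays) lie in $[c_1,c_2]$. *)

(* Defs.v *)
From HB Require Import structures.
From mathcomp Require Import all_boot all_order all_algebra.
From mathcomp Require Import sesquilinear spectral.
From mathcomp.real_closed Require Import complex mxtens.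
From mathcomp Require Import all_classical all_reals all_analysis.
Import Order.TTheory GRing.Theory Num.Theory.
Import numFieldNormedType.Exports.

Set Implicit Arguments.
Unset Strict Implicit.
Unset Printing Implicit Defensive.

Local Open Scope ring_scope.
Local Open Scope complex_scope.
Local Open Scope sesquilinear_scope.

(* Transmit element m sits at m * tx_step and receive element n at n * rx_step;
   all positions and apertures are measured in units of the grid spacing d. *)
Record array := Array {
  num_tx : nat;
  num_rx : nat;
  tx_step : nat;
  rx_step : nat }.

Definition cpa (M1 M2 : nat) : array := Array M1 M2 M2 M1.

Definition ula (N1 N2 : nat) : array := Array N1 N2 1 1.

Definition cpa_aperture (M1 M2 : nat) : nat :=
  maxn ((M1 - 1) * M2) ((M2 - 1) * M1).

Definition ula_aperture (MU : nat) : nat := (MU - 1)%N.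

Section Model.
Variable R : realType.

Definition cis (x : R) : R[i] := cos x +i* sin x.

Definition steering (N s : nat) (w : R) : 'cV[R[i]]_N :=
  \col_(m < N) cis ((m * s)%:R * w).

Definition manifold (a : array) (w : R) : 'cV[R[i]]_(num_tx a * num_rx a) :=
  map_mx conjc (steering (num_tx a) (tx_step a) w)
    *t map_mx conjc (steering (num_rx a) (rx_step a) w).

(* The parameter vector stacks omega, Re beta and Im beta. *)
Definition params (K : nat) (omega : 'cV[R]_K) (beta : 'cV[R[i]]_K) :
    'cV[R]_(K + (K + K)) :=
  col_mx omega (col_mx (map_mx (@complex.Re R) beta)
                       (map_mx (@complex.Im R) beta)).

Definition mean_signal (a : array) (K : nat) (xi : 'cV[R]_(K + (K + K))) :
    'cV[R[i]]_(num_tx a * num_rx a) :=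
  \sum_(m < K)
    (usubmx (dsubmx xi) m 0 +i* dsubmx (dsubmx xi) m 0)
      *: manifold a (usubmx xi m 0).

(* R[i] carries no normed structure over R in the library, so a complex-valued
   function of a real variable is differentiated through its real and
   imaginary parts. *)
Definition cderive1 (f : R -> R[i]) (t : R) : R[i] :=
  derive1 (fun x => complex.Re (f x)) t +i* derive1 (fun x => complex.Im (f x)) t.

Definition partial (n p : nat) (f : 'cV[R]_n -> 'cV[R[i]]_p) (i : 'I_n)
    (xi : 'cV[R]_n) : 'cV[R[i]]_p :=
  \col_j cderive1 (fun t : R => f (xi + t *: delta_mx i 0) j 0) 0.

Definition fisher (a : array) (K : nat) (Rs : 'M[R[i]]_(num_tx a))
    (L sigma : R) (omega : 'cV[R]_K) (beta : 'cV[R[i]]_K) :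
    'M[R]_(K + (K + K)) :=
  let xi := params omega beta in
  let dpsi i := partial (@mean_signal a K) i xi in
  \matrix_(i, k)
    (2 * L / sigma ^+ 2 *
     complex.Re (((dpsi i)^t* *m (Rs^T *t (1%:M : 'M[R[i]]_(num_rx a))) *m dpsi k)
                   0 0)).

Definition crb_omega (a : array) (K : nat) (Rs : 'M[R[i]]_(num_tx a))
    (L sigma : R) (omega : 'cV[R]_K) (beta : 'cV[R[i]]_K) : 'M[R]_K :=
  let F := fisher Rs L sigma omega beta in
  invmx (ulsubmx F - ursubmx F *m invmx (drsubmx F) *m dlsubmx F).

Definition posdefmx (n : nat) (A : 'M[R[i]]_n) : Prop :=
  A \is hermsymmx /\
  forall v : 'cV[R[i]]_n, v != 0 -> 0 < (v^t* *m A *m v) 0 0.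

(* The order on R[i] only compares numbers with equal imaginary parts, so the
   bounds below also say that the eigenvalues are real. *)
Definition spectrum_in (n : nat) (A : 'M[R[i]]_n) (c1 c2 : R) : Prop :=
  forall z : R[i], eigenvalue A z -> c1%:C <= z <= c2%:C.

Definition admissible_covariance (n : nat) (p c1 c2 : R) (A : 'M[R[i]]_n) :
    Prop :=
  [/\ posdefmx A, forall i, A i i = p%:C & spectrum_in A c1 c2].

End Model.

(* Main.v *)
(* Both arrays are governed by one non-asymptotic lower bound on the Fisher
   information.  For a fixed receive element the tangent of the mean signal in
   direction xi is, along the transmit elements, an exponential sum
   i |-> \sum_m (a_m i + b_m) y_m ^ i with |a_m| = |beta_m| tx_step |xi_m|.
   Applying (shift - y_n)^2 for every n <> m removes all other targets, costs
   at most a factor 16 each in energy, and keeps the slope of target m up to a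
   factor at least (2 delta)^2 each.  An affine sequence of slope a has energy
   of order |a|^2 N^3, so that
     xi^T F xi >= const * L * num_rx * num_tx^3 * tx_step^2 * xi_m^2,
   whatever the nuisance coordinates of xi are.  Hence the CRB of the ULA is
   O(1 / (L X^4)) with X = N1 + N2 of the order of M1 M2, whereas the CRB of
   the CPA is at least the inverse of a diagonal entry of F, which is
   O(L (M1 M2)^3).  Equal CRBs force Lula / Lcpa = O(1 / (M1 M2)). *)
Require Import Defs.
From mathcomp Require Import all_boot all_order all_algebra.
From mathcomp Require Import sesquilinear spectral ring lra zify.
From mathcomp.real_closed Require Import complex mxtens.
From mathcomp Require Import all_classical all_reals all_analysis.
Import Order.TTheory GRing.Theory Num.Theory.
Import numFieldNormedType.Exports.

Set Implicit Arguments.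
Unset Strict Implicit.
Unset Printing Implicit Defensive.

Local Open Scope classical_set_scope.
Local Open Scope ring_scope.
Local Open Scope complex_scope.
Local Open Scope sesquilinear_scope.

(** * Exponential sums with affine coefficients *)

Section ExponentialSums.
Variable C : numFieldType.

Lemma sqr_normB_le (x y : C) : `|x - y| ^+ 2 <= 2 * (`|x| ^+ 2 + `|y| ^+ 2).
Proof.
apply: (@le_trans _ _ ((`|x| + `|y|) ^+ 2)).
  by rewrite lerXn2r ?nnegrE ?addr_ge0 ?ler_normB.
rewrite -subr_ge0.
have -> : 2 * (`|x| ^+ 2 + `|y| ^+ 2) - (`|x| + `|y|) ^+ 2 = (`|x| - `|y|) ^+ 2 by ring.
by rewrite real_exprn_even_ge0 // rpredB ?normr_real.
Qed.

(** Kills [i |-> z ^+ i]; applied twice it kills [i |-> (a * i%:R + b) * z ^+ i], the whole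
    contribution of a target with node [z]. *)
Definition twisted_diff (z : C) (f : nat -> C) (i : nat) : C := f i.+1 - z * f i.

Lemma twisted_diff_le (z : C) (f : nat -> C) n : `|z| = 1 ->
  \sum_(i < n) `|twisted_diff z f i| ^+ 2 <= 4 * \sum_(i < n.+1) `|f i| ^+ 2.
Proof.
move=> z1.
apply: (@le_trans _ _ (\sum_(i < n) 2 * (`|f i.+1| ^+ 2 + `|f i| ^+ 2))).
  apply: ler_sum => i _; apply: le_trans (sqr_normB_le _ _) _.
  by rewrite normrM z1 mul1r.
rewrite -mulr_sumr big_split /=.
have -> : (4 : C) = 2 * 2 by ring.
rewrite -mulrA ler_pM2l // mulr_natl mulr2n lerD //.
  by rewrite big_ord_recl lerDr exprn_ge0.
by rewrite big_ord_recr lerDl exprn_ge0.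
Qed.

Lemma twisted_diff2_le (z : C) (f : nat -> C) n : `|z| = 1 ->
  \sum_(i < n) `|twisted_diff z (twisted_diff z f) i| ^+ 2
    <= 16 * \sum_(i < n.+2) `|f i| ^+ 2.
Proof.
move=> z1; apply: le_trans (twisted_diff_le _ _ z1) _.
have -> : (16 : C) = 4 * 4 by ring.
by rewrite -mulrA ler_pM2l // twisted_diff_le.
Qed.

Lemma twisted_diff2_affine (a b y z : C) (i : nat) :
  twisted_diff z (twisted_diff z (fun i => (a * i%:R + b) * y ^+ i)) i =
  (a * (y - z) ^+ 2 * i%:R + (b * (y - z) ^+ 2 + 2 * a * y * (y - z))) * y ^+ i.
Proof. by rewrite /twisted_diff !exprS -[i.+2]addn2 -[i.+1]addn1 !natrD; ring. Qed.

Lemma twisted_diff2_sum (I : Type) (s : seq I) (z : C) (f : I -> nat -> C) i :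
  twisted_diff z (twisted_diff z (fun i => \sum_(m <- s) f m i)) i =
  \sum_(m <- s) twisted_diff z (twisted_diff z (f m)) i.
Proof. by rewrite /twisted_diff sumrB -mulr_sumr !sumrB -!mulr_sumr. Qed.

(* The squared twisted difference at the node of a target annihilates that
   target and multiplies the slopes of the others by squared node gaps. *)
Lemma isolate_node (I : eqType) (y : I -> C) (m0 : I) (s : seq I) (d : C)
    (a b : I -> C) :
  (forall m, `|y m| = 1) -> 0 <= d ->
  (forall m, m \in s -> d <= `|y m0 - y m|) ->
  exists q c, [/\ d ^+ (2 * size s) <= `|q|, a m0 = 0 -> c = q * b m0 &
    forall n, \sum_(i < n) `|q * a m0 * i%:R + c| ^+ 2 <=
      16 ^+ size s * \sum_(i < n + 2 * size s)
        `|\sum_(m <- m0 :: s) (a m * i%:R + b m) * y m ^+ i| ^+ 2].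
Proof.
move=> y1 d0; elim: s a b => [|m1 s IH] a b gap.
  exists 1, (b m0); split=> [||n]; rewrite ?mul1r ?muln0 ?addn0 ?expr0 ?normr1 //.
  apply: ler_sum => i _.
  by rewrite big_seq1 [X in _ <= X ^+ _]normrM normrX y1 expr1n mulr1.
(* Coefficients left by the double difference at [y m1], read off [twisted_diff2_affine]; the
   induction hypothesis is applied to them. *)
pose a' m := a m * (y m - y m1) ^+ 2.
pose b' m := b m * (y m - y m1) ^+ 2 + 2 * a m * y m * (y m - y m1).
have gap' m : m \in s -> d <= `|y m0 - y m|.
  by move=> ms; apply: gap; rewrite inE ms orbT.
have [q [c [dq c0 H]]] := IH a' b' gap'.
exists (q * (y m0 - y m1) ^+ 2), c; split=> [|am0|n].
- rewrite /= mulnS addnC exprD normrM normrX ler_pM ?exprn_ge0 //.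
  by rewrite lerXn2r ?nnegrE ?gap // inE eqxx.
- by rewrite c0 /a' /b' am0 ?mul0r //; ring.
have -> : q * (y m0 - y m1) ^+ 2 * a m0 = q * a' m0 by rewrite /a'; ring.
apply: le_trans (H n) _.
rewrite /= mulnS addnCA add2n exprSr -mulrA ler_pM2l ?exprn_gt0 //.
pose f i := \sum_(m <- [:: m0, m1 & s]) (a m * i%:R + b m) * y m ^+ i.
apply: le_trans (twisted_diff2_le f (n + 2 * size s) (y1 m1)).
apply: ler_sum => i _; rewrite /f twisted_diff2_sum !big_cons.
rewrite !twisted_diff2_affine subrr expr0n /= !(mulr0, mul0r, addr0, add0r).
by under [in leRHS]eq_bigr => m _ do rewrite (twisted_diff2_affine (a m) (b m)).
Qed.

(* Indices i and i + h are paired: the two terms differ by a * h. *)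
Lemma affine_energy_ge (a c : C) (h : nat) :
  `|a| ^+ 2 * h%:R ^+ 3 <= 2 * \sum_(i < h + h) `|a * i%:R + c| ^+ 2.
Proof.
rewrite big_split_ord /= -big_split /= mulr_sumr.
have -> : `|a| ^+ 2 * h%:R ^+ 3 = \sum_(i < h) `|a * h%:R| ^+ 2.
  by rewrite sumr_const card_ord normrM normr_nat -mulr_natr; ring.
apply: ler_sum => i _.
have -> : a * h%:R = (a * (h + i)%:R + c) - (a * i%:R + c) by rewrite natrD; ring.
by apply: le_trans (sqr_normB_le _ _) _; rewrite addrC.
Qed.

Lemma sum_nneg_widen (n N : nat) (F : nat -> C) : (forall i, 0 <= F i) ->
  (n <= N)%N -> \sum_(i < n) F i <= \sum_(i < N) F i.
Proof.
move=> F0 /subnKC <-; rewrite big_split_ord /= lerDl.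
by apply: sumr_ge0.
Qed.

(** * Exponential sums with separated nodes *)

Section Nodes.
Variables (K : nat) (y : 'I_K -> C) (d : C) (m0 : 'I_K).
Hypothesis y1 : forall m, `|y m| = 1.
Hypothesis d_ge0 : 0 <= d.
Hypothesis gap : forall m, m != m0 -> 2 * d <= `|y m0 - y m|.

Let others := rem m0 (enum 'I_K).

Let size_others : size others = K.-1.
Proof. by rewrite size_rem ?mem_enum // size_enum_ord. Qed.

Let gap_others m : m \in others -> 2 * d <= `|y m0 - y m|.
Proof. by rewrite mem_rem_uniq ?enum_uniq // inE => /andP[/gap]. Qed.

Let sum_others (F : 'I_K -> C) : \sum_(m <- m0 :: others) F m = \sum_m F m.
Proof.
rewrite -big_enum; apply/esym/perm_big.
by apply: perm_to_rem; rewrite mem_enum.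
Qed.

(** Isolating [m0] leaves an affine sequence of slope [q * a m0], to which [affine_energy_ge]
    applies. The [2 * K.-1] spare indices are those consumed by the double differences at the other
    nodes. *)
Lemma exp_sum_energy_ge (a b : 'I_K -> C) (h N : nat) :
  (h + h + 2 * K.-1 <= N)%N ->
  `|a m0| ^+ 2 * d ^+ (4 * K.-1) * h%:R ^+ 3 <=
  2 * \sum_(i < N) `|\sum_m (a m * i%:R + b m) * y m ^+ i| ^+ 2.
Proof.
move=> hN; have d2_ge0 : 0 <= 2 * d by rewrite mulr_ge0.
have [q [c [qd _ H]]] := isolate_node a b y1 d2_ge0 gap_others.
rewrite -(ler_pM2l (_ : 0 < 16 ^+ K.-1)) ?exprn_gt0 //.
(* Each removed node contributes [(2 * d) ^+ 4 = 16 * d ^+ 4] to the squared slope, which absorbs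
   its loss factor 16; hence the normalisation [2 * d] of the gap. *)
have -> : 16 ^+ K.-1 * (`|a m0| ^+ 2 * d ^+ (4 * K.-1) * h%:R ^+ 3) =
  ((2 * d) ^+ (2 * K.-1)) ^+ 2 * `|a m0| ^+ 2 * h%:R ^+ 3.
  rewrite !exprMn -!exprM -mulnA [(_ * 2)%N]mulnC mulnA.
  have -> : (16 : C) = 2 ^+ 4 by ring.
  by rewrite -exprM; ring.
apply: (@le_trans _ _ (`|q * a m0| ^+ 2 * h%:R ^+ 3)).
  rewrite ler_wpM2r ?exprn_ge0 // normrM [(`|q| * _) ^+ 2]exprMn ler_wpM2r ?exprn_ge0 //.
  by rewrite -size_others lerXn2r ?nnegrE ?exprn_ge0.
apply: le_trans (affine_energy_ge _ c h) _.
rewrite mulrCA ler_pM2l //; apply: le_trans (H _) _.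
rewrite size_others ler_pM2l ?exprn_gt0 //.
under eq_bigr do rewrite sum_others.
pose f i := `|\sum_m (a m * i%:R + b m) * y m ^+ i| ^+ 2.
by apply: (@sum_nneg_widen _ _ f) => // *; apply: exprn_ge0.
Qed.

(** With zero slope at [m0], isolation leaves the constant [q * b m0], and [q] is nonzero because
    the gaps are positive. One surviving index suffices to conclude. *)
Lemma exp_sum_eq0 (a b : 'I_K -> C) (N : nat) : d != 0 ->
  (2 * K.-1 < N)%N ->
  (forall i, (i < N)%N -> \sum_m (a m * i%:R + b m) * y m ^+ i = 0) ->
  a m0 = 0 -> b m0 = 0.
Proof.
move=> d0 KN f0 am0; have d2_ge0 : 0 <= 2 * d by rewrite mulr_ge0.
have [q [c [qd cE /(_ 1%N)]]] := isolate_node a b y1 d2_ge0 gap_others.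
rewrite big_ord1 mulr0 add0r size_others big1 ?mulr0 => [|i _]; last first.
  rewrite sum_others f0 ?normr0 ?expr0n //.
  by apply: leq_trans (ltn_ord i) _.
rewrite real_exprn_even_le0 ?normr_real // normr_eq0 cE // mulf_eq0.
case/orP=> [/eqP q0|/eqP//].
have : 0 < (2 * d) ^+ (2 * size others).
  by rewrite exprn_gt0 // mulr_gt0 // lt_def d0.
by move=> /lt_le_trans /(_ qd); rewrite q0 normr0 ltxx.
Qed.

End Nodes.
End ExponentialSums.

(** * Schur complements of positive definite matrices *)

Section SchurComplement.
Variable R : realFieldType.

Definition qform (n : nat) (F : 'M[R]_n) (x : 'cV[R]_n) : R := (x^T *m F *m x) 0 0.

Lemma posdef_unit (n : nat) (F : 'M[R]_n) :
  (forall x, x != 0 -> 0 < qform F x) -> F \in unitmx.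
Proof.
move=> Fpos; rewrite -unitmx_tr -row_free_unit -kermx_eq0; apply/rowV0P => v.
move=> /sub_kermxP vF; apply/eqP/negPn/negP => v0.
have := Fpos v^T; rewrite trmx_eq0 => /(_ v0).
have -> : qform F v^T = (v *m (F *m v^T)) 0 0 by rewrite /qform trmxK mulmxA.
have -> : F *m v^T = (v *m F^T)^T by rewrite trmx_mul trmxK.
by rewrite vF trmx0 mulmx0 mxE ltxx.
Qed.

Lemma delta_neq0 (n : nat) (i : 'I_n) : delta_mx i 0 != 0 :> 'cV[R]_n.
Proof.
by apply/eqP => /matrixP /(_ i 0); rewrite !mxE !eqxx /= => /eqP; rewrite oner_eq0.
Qed.

Lemma qform_delta (n : nat) (F : 'M[R]_n) (i : 'I_n) : qform F (delta_mx i 0) = F i i.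
Proof. by rewrite /qform trmx_delta -rowE -colE !mxE. Qed.

Definition schur (n q : nat) (F : 'M[R]_(n + q)) : 'M[R]_n :=
  ulsubmx F - ursubmx F *m invmx (drsubmx F) *m dlsubmx F.

Variables (n q : nat) (F : 'M[R]_(n + q)).
Hypothesis Fpos : forall x, x != 0 -> 0 < qform F x.

Lemma drsubmx_unit : drsubmx F \in unitmx.
Proof.
apply: posdef_unit => x x0.
have := Fpos (x := col_mx 0 x); rewrite col_mx_eq0 eqxx => /(_ x0).
by rewrite /qform -{1}(submxK F) tr_col_mx mul_row_block mul_row_col trmx0
   !mul0mx !add0r mulmx0 add0r.
Qed.

(** The nuisance coordinates are chosen to cancel the lower block of [F *m lift_schur u]; on such
    vectors the form of [F] is that of its Schur complement. *)
Let lift_schur (u : 'cV[R]_n) : 'cV[R]_(n + q) :=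
  col_mx u (- (invmx (drsubmx F) *m dlsubmx F *m u)).

Lemma mul_lift_schur u : F *m lift_schur u = col_mx (schur F *m u) 0.
Proof.
rewrite -{1}(submxK F) mul_block_col !mulmxN !mulmxA; congr col_mx.
  by rewrite /schur mulmxBl.
by rewrite mulmxV ?drsubmx_unit // mul1mx subrr.
Qed.

Lemma schur_unit : schur F \in unitmx.
Proof.
apply: posdef_unit => u u0.
have := Fpos (x := lift_schur u); rewrite col_mx_eq0 negb_and u0 => /(_ isT).
by rewrite /qform -mulmxA mul_lift_schur tr_col_mx mul_row_col mulmx0 addr0 mulmxA.
Qed.

(* Such an x also satisfies x^T F x = x_m, so a diagonal entry of the inverse
   Schur complement is at once a coordinate and an energy; comparing the two
   gives the bounds below. *)
Lemma schur_inv_solution (m : 'I_n) : exists x : 'cV[R]_(n + q),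
  F *m x = delta_mx (lshift q m) 0 /\ x (lshift q m) 0 = invmx (schur F) m m.
Proof.
exists (lift_schur (col m (invmx (schur F)))); split.
  by rewrite mul_lift_schur colE mulmxA mulmxV ?schur_unit // mul1mx delta_mx_ushift.
by rewrite col_mxEu mxE.
Qed.

Lemma qform_solution (x : 'cV[R]_(n + q)) (i : 'I_(n + q)) :
  F *m x = delta_mx i 0 -> qform F x = x i 0.
Proof.
by move=> Fx; rewrite /qform -mulmxA Fx -colE !mxE.
Qed.

(** For the solution [x] the entry [t] is also its energy, so the hypothesis reads
    [C * t ^+ 2 <= t]. *)
Lemma schur_inv_le (C : R) (m : 'I_n) : 0 < C ->
  (forall x : 'cV[R]_(n + q), C * x (lshift q m) 0 ^+ 2 <= qform F x) ->
  invmx (schur F) m m <= C^-1.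
Proof.
move=> C0 HC; have [x [Fx <-]] := schur_inv_solution m.
have := HC x; rewrite (qform_solution Fx); set t := x _ _ => H.
rewrite -[C^-1]mul1r ler_pdivlMr // mulrC.
have [t0|t0] := leP t 0; first by apply: le_trans ler01; rewrite pmulr_rle0.
by rewrite -(ler_pM2r t0) mul1r -mulrA -expr2.
Qed.

Lemma schur_inv_gt0 (m : 'I_n) : 0 < invmx (schur F) m m.
Proof.
have [x [Fx <-]] := schur_inv_solution m.
rewrite -(qform_solution Fx); apply: Fpos; apply/eqP => x0.
move: Fx; rewrite x0 mulmx0 => /matrixP /(_ (lshift q m) 0).
by rewrite !mxE !eqxx /= => /eqP; rewrite eq_sym oner_eq0.
Qed.

(** Cauchy-Schwarz for the form [F] between the unit vector and the solution [x]: their product is 1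
    and their energies are [F i i] and [t]. *)
Lemma schur_inv_ge (m : 'I_n) : F^T = F ->
  (F (lshift q m) (lshift q m))^-1 <= invmx (schur F) m m.
Proof.
move=> Fsym; have := schur_inv_gt0 m.
have [x [Fx <-]] := schur_inv_solution m; set i := lshift q m.
set t := x i 0 => t0.
have Fii : 0 < F i i by rewrite -qform_delta Fpos ?delta_neq0.
(* The factor [t^-1] minimises the form along this line, where its value is [F i i - t^-1]. *)
have : 0 <= qform F (delta_mx i 0 - t^-1 *: x).
  have [->|/Fpos/ltW//] := eqVneq (delta_mx i 0 - t^-1 *: x) 0.
  by rewrite /qform mulmx0 mxE.
have -> : forall y, qform F (y - t^-1 *: x) = qform F y -
  (y^T *m (F *m x)) 0 0 / t - ((F *m x)^T *m y) 0 0 / t + t^-2 * qform F x.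
  move=> y; rewrite trmx_mul Fsym /qform [(_ - _)^T]linearB /= [(_ *: _)^T]linearZ /=.
  rewrite !(mulmxBl, mulmxBr) -!(scalemxAl, scalemxAr) !mulmxA.
  by rewrite !mxE; field; rewrite gt_eqF.
rewrite (qform_solution Fx) Fx -/i -/t qform_delta !trmx_delta -!colE.
rewrite !mxE !eqxx /= => H.
rewrite -(ler_pM2l Fii) mulfV ?gt_eqF // -subr_ge0.
have -> : F i i * t - 1 = t * (F i i - 1 / t - 1 / t + t ^- 2 * t).
  by field; rewrite gt_eqF.
by rewrite mulr_ge0 // ltW.
Qed.
End SchurComplement.

(** * Hermitian forms *)

Section Hermitian.
Variable R : realType.

Lemma conjC_conjc (z : R[i]) : Num.conj z = conjc z.
Proof. by []. Qed.

Lemma dot_diagE (n : nat) (s : 'rV[R[i]]_n) (w : 'cV[R[i]]_n) :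
  (w^t* *m diag_mx s *m w) 0 0 = \sum_i s 0 i * `|w i 0| ^+ 2.
Proof.
rewrite mxE; apply: eq_bigr => i _.
rewrite mul_mx_diag !mxE sqr_normc conjC_conjc; ring.
Qed.

Lemma dotE (n : nat) (w : 'cV[R[i]]_n) :
  (w^t* *m w) 0 0 = \sum_i `|w i 0| ^+ 2.
Proof.
by rewrite mxE; apply: eq_bigr => i _; rewrite !mxE sqr_normc conjC_conjc mulrC.
Qed.

(** Rayleigh quotient bound: in an orthonormal eigenbasis the form is a sum of squared moduli
    weighted by eigenvalues. *)
Lemma hermitian_bounds (n : nat) (A : 'M[R[i]]_n) (c1 c2 : R) (v : 'cV[R[i]]_n) :
  A \is hermsymmx -> spectrum_in A c1 c2 ->
  c1%:C * (\sum_i `|v i 0| ^+ 2) <= (v^t* *m A *m v) 0 0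
    <= c2%:C * (\sum_i `|v i 0| ^+ 2).
Proof.
move=> Aherm Aspec.
have := hermitian_normalmx Aherm => /orthomx_spectralP.
set P := spectralmx A; set s := spectral_diag A => Aeq.
have Pu : P \is unitarymx by exact: spectral_unitarymx.
have Punit : P \in unitmx by exact: unitarymx_unit.
(* The rows of [P] are eigenvectors, nonzero since [P] is invertible, so each spectral coefficient
   is an eigenvalue of [A]. *)
have sP i : c1%:C <= s 0 i <= c2%:C.
  apply: Aspec; apply/eigenvalueP; exists (row i P).
    rewrite -row_mul Aeq !mulmxA mulmxV // mul1mx row_mul.
    by apply/rowP => j; rewrite row_diag_mx -scalemxAl -rowE !mxE.
  apply/eqP => Pi0; have := mulmxK Punit (delta_mx 0 i : 'rV_n).
  rewrite -rowE Pi0 mul0mx => /matrixP /(_ 0 i) /eqP.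
  by rewrite !mxE !eqxx eq_sym oner_eq0.
rewrite -dotE.
have -> : v^t* *m A *m v = (P *m v)^t* *m diag_mx s *m (P *m v).
  by rewrite {1}Aeq invmx_unitary // trmx_mul map_mxM !mulmxA.
have -> : v^t* *m v = (P *m v)^t* *m (P *m v).
  rewrite trmx_mul map_mxM mulmxA -[_ *m _ *m P]mulmxA -invmx_unitary //.
  by rewrite mulVmx // mulmx1.
rewrite dot_diagE dotE !mulr_sumr; apply/andP; split; apply: ler_sum => i _;
  by apply: ler_wpM2r; rewrite ?exprn_ge0 //; case/andP: (sP i).
Qed.

Lemma sum_mxtens (V : nmodType) (m n : nat) (F : 'I_(m * n) -> V) :
  \sum_j F j = \sum_(k < n) \sum_(i < m) F (mxtens_index (i, k)).
Proof.
rewrite exchange_big pair_big /= (reindex (@mxtens_index m n)) /=.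
  by apply: eq_bigr => -[].
by exists (@mxtens_unindex m n) => j _; rewrite (mxtens_indexK, mxtens_unindexK).
Qed.

(** The identity factor decouples the receive elements [k]; conjugating each slice turns the
    transpose of [Q] back into [Q]. *)
Lemma tens1_qform (m n : nat) (Q : 'M[R[i]]_m) (d : 'cV[R[i]]_(m * n)) :
  (d^t* *m (Q^T *t (1%:M : 'M[R[i]]_n)) *m d) 0 0 =
  \sum_(k < n) let v := \col_(i < m) conjc (d (mxtens_index (i, k)) 0) in
     (v^t* *m Q *m v) 0 0.
Proof.
rewrite mxE sum_mxtens; apply: eq_bigr => k _ /=; rewrite -mulmxA mxE.
apply: eq_bigr => i _; rewrite !mxE conjC_conjc conjcK mulrC; congr (_ * _).
rewrite sum_mxtens (bigD1 k) //= [X in _ + X]big1 ?addr0 => [|l lk]; last first.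
  by apply: big1 => j _; rewrite tensmxE !mxE (negPf lk) !mulr0.
by apply: eq_bigr => j _; rewrite tensmxE !mxE eqxx mulr1 conjC_conjc mulrC.
Qed.

Lemma tens1_bounds (m n : nat) (Q : 'M[R[i]]_m) (c1 c2 : R) (d : 'cV[R[i]]_(m * n)) :
  Q \is hermsymmx -> spectrum_in Q c1 c2 ->
  c1%:C * (\sum_j `|d j 0| ^+ 2) <= (d^t* *m (Q^T *t (1%:M : 'M[R[i]]_n)) *m d) 0 0
    <= c2%:C * (\sum_j `|d j 0| ^+ 2).
Proof.
move=> Qh Qs; rewrite tens1_qform sum_mxtens !mulr_sumr.
pose v k := \col_(i < m) conjc (d (mxtens_index (i, k)) 0).
apply/andP; split; apply: ler_sum => k _.
  have /andP[+ _] := hermitian_bounds (v k) Qh Qs.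
  by under eq_bigr do rewrite mxE normcJ.
have /andP[_ +] := hermitian_bounds (v k) Qh Qs.
by under [in leRHS]eq_bigr do rewrite mxE normcJ.
Qed.

Lemma tens1_hermitian (m n : nat) (Q : 'M[R[i]]_m) :
  Q \is hermsymmx -> (Q^T *t (1%:M : 'M[R[i]]_n))^t* = Q^T *t (1%:M : 'M[R[i]]_n).
Proof.
move=> /is_hermitianmxP; rewrite scale1r => Qh; rewrite trmx_tens map_mxT trmx1 map_mx1.
by rewrite trmxK {2}Qh -map_trmx trmxK.
Qed.

End Hermitian.

(** * Fisher information of an array *)

Section Tangent.
Variable R : realType.

(** The product of [p +i* q] with the conjugate of [cis] has real part [p cos + q sin]; its
    imaginary part is the same expression with [(q, - p)] for [(p, q)]. One derivative thus serves
    both parts. *)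
Lemma is_derive_trig (p dp q dq x w dw : R) :
  is_derive (0 : R) 1
    (fun t : R => (p + t * dp) * cos (x * (w + t * dw))
                + (q + t * dq) * sin (x * (w + t * dw)))
    ((dp + q * x * dw) * cos (x * w) + (dq - p * x * dw) * sin (x * w)).
Proof.
have aff (u v : R) : is_derive (0 : R) 1 (fun t : R => u + t * v) v.
  by apply: is_derive_eq; rewrite /GRing.scale /=; ring.
have arg : is_derive (0 : R) 1 (fun t : R => x * (w + t * dw)) (x * dw).
  by apply: is_derive_eq; rewrite /GRing.scale /=; ring.
have dcos : is_derive (0 : R) 1 (fun t : R => cos (x * (w + t * dw)))
    (- sin (x * (w + 0 * dw)) * (x * dw)).
  exact: (@is_derive1_comp _ (@cos R) (fun t : R => x * (w + t * dw))).
have dsin : is_derive (0 : R) 1 (fun t : R => sin (x * (w + t * dw)))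
    (cos (x * (w + 0 * dw)) * (x * dw)).
  exact: (@is_derive1_comp _ (@sin R) (fun t : R => x * (w + t * dw))).
have ap := aff p dp; have aq := aff q dq.
apply: is_derive_eq; rewrite /GRing.scale /= !mul0r !addr0; ring.
Qed.

Lemma derive1_sum_trig (K : nat) (p dp q dq w dw : 'I_K -> R) (x : R) :
  derive1 (fun t : R => \sum_m ((p m + t * dp m) * cos (x * (w m + t * dw m))
                + (q m + t * dq m) * sin (x * (w m + t * dw m)))) 0 =
  \sum_m ((dp m + q m * x * dw m) * cos (x * w m)
             + (dq m - p m * x * dw m) * sin (x * w m)).
Proof.
rewrite derive1E.
have H m := is_derive_trig (p m) (dp m) (q m) (dq m) x (w m) (dw m).
have := is_derive_sum H => - [_].
by rewrite fct_sumE.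
Qed.

Lemma cisD (x y : R) : cis (x + y) = cis x * cis y.
Proof. by rewrite /cis sinD cosD; simpc; congr (_ +i* _); ring. Qed.

Lemma Re_sum (I : Type) (s : seq I) (F : I -> R[i]) :
  complex.Re (\sum_(i <- s) F i) = \sum_(i <- s) complex.Re (F i).
Proof. by apply: (big_morph (@complex.Re R)) => // -[? ?] []. Qed.

Lemma Im_sum (I : Type) (s : seq I) (F : I -> R[i]) :
  complex.Im (\sum_(i <- s) F i) = \sum_(i <- s) complex.Im (F i).
Proof. by apply: (big_morph (@complex.Im R)) => // -[? ?] []. Qed.

Definition position (a : array) (j : 'I_(num_tx a * num_rx a)) : R :=
  ((mxtens_unindex j).1 * tx_step a)%:R + ((mxtens_unindex j).2 * rx_step a)%:R.

Lemma manifoldE (a : array) (w : R) j :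
  manifold a w j 0 = conjc (cis (position j * w)).
Proof. by rewrite !mxE mulrDl cisD [RHS](rmorphM (@conjc R)). Qed.

Definition freq_part (K : nat) (xi : 'cV[R]_(K + (K + K))) m := usubmx xi m 0.
Definition coef_part (K : nat) (xi : 'cV[R]_(K + (K + K))) (m : 'I_K) : R[i] :=
  usubmx (dsubmx xi) m 0 +i* dsubmx (dsubmx xi) m 0.

(** Closed form of the derivative of [mean_signal] in direction [xi]; the factor [0 -i* position]
    comes from differentiating the conjugated phase. *)
Definition tangent (a : array) (K : nat) (omega : 'cV[R]_K) (beta : 'cV[R[i]]_K)
    (xi : 'cV[R]_(K + (K + K))) : 'cV[R[i]]_(num_tx a * num_rx a) :=
  \col_j \sum_m (coef_part xi m + beta m 0 * (0 -i* (position j * freq_part xi m)))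
           * conjc (cis (position j * omega m 0)).

Lemma partial_tangent (a : array) (K : nat) (omega : 'cV[R]_K) (beta : 'cV[R[i]]_K) i :
  partial (@mean_signal R a K) i (params omega beta) =
  tangent a omega beta (delta_mx i 0).
Proof.
apply/colP => j; rewrite !mxE /cderive1.
set xi := params omega beta; set e := delta_mx i 0.
pose p m := usubmx (dsubmx xi) m 0; pose dp m := usubmx (dsubmx e) m 0.
pose q m := dsubmx (dsubmx xi) m 0; pose dq m := dsubmx (dsubmx e) m 0.
pose w m := usubmx xi m 0; pose dw m := usubmx e m 0.
have bE m : beta m 0 = p m +i* q m.
  by rewrite /p /q /xi /params col_mxKd col_mxKu col_mxKd !mxE; case: (beta m 0).
have wE m : omega m 0 = w m by rewrite /w /xi /params col_mxKu.
have E (t : R) : mean_signal a (xi + t *: e) j 0 =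
  \sum_m ((p m + t * dp m) +i* (q m + t * dq m)) *
     conjc (cis (position j * (w m + t * dw m))).
  rewrite /mean_signal summxE; apply: eq_bigr => m _.
  by rewrite mxE manifoldE /p /q /w /dp /dq /dw !mxE.
have -> : (fun x : R => complex.Re (mean_signal a (xi + x *: e) j 0)) =
  fun t : R => \sum_m ((p m + t * dp m) * cos (position j * (w m + t * dw m))
                + (q m + t * dq m) * sin (position j * (w m + t * dw m))).
  apply/funext => t; rewrite E Re_sum; apply: eq_bigr => m _.
  by rewrite /cis; simpc; rewrite /=; ring.
have -> : (fun x : R => complex.Im (mean_signal a (xi + x *: e) j 0)) =
  fun t : R => \sum_m ((q m + t * dq m) * cos (position j * (w m + t * dw m))
                + (- p m + t * - dp m) * sin (position j * (w m + t * dw m))).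
  apply/funext => t; rewrite E Im_sum; apply: eq_bigr => m _.
  by rewrite /cis; simpc; rewrite /=; ring.
rewrite !derive1_sum_trig.
apply/eqP; rewrite eq_complex /= Re_sum Im_sum; apply/andP; split; apply/eqP;
  apply: eq_bigr => m _;
  rewrite bE wE /coef_part /freq_part -/(dp m) -/(dq m) -/(dw m) /cis;
  simpc; rewrite /=; ring.
Qed.

Lemma tangent_sum (a : array) (K : nat) (omega : 'cV[R]_K) (beta : 'cV[R[i]]_K) xi :
  tangent a omega beta xi =
  \sum_i (xi i 0)%:C *: tangent a omega beta (delta_mx i 0).
Proof.
apply/colP => j; rewrite summxE mxE.
under [RHS]eq_bigr => i _ do rewrite !mxE mulr_sumr.
rewrite exchange_big; apply: eq_bigr => m _ /=.
under [RHS]eq_bigr => i _ do rewrite mulrA.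
rewrite -mulr_suml; congr (_ * _).
have xiE (k : 'I_(K + (K + K))) :
    xi k 0 = \sum_i xi i 0 * (delta_mx i 0 : 'cV_(K + (K + K))) k 0.
  rewrite (bigD1 k) //= big1 ?addr0 => [|l /negPf lk]; rewrite !mxE.
    by rewrite !eqxx mulr1.
  by rewrite [k == l]eq_sym lk mulr0.
have freqE : freq_part xi m = \sum_i xi i 0 * freq_part (delta_mx i 0) m.
  by rewrite /freq_part mxE xiE; apply: eq_bigr => i _; rewrite !mxE.
have coefE : coef_part xi m = \sum_i (xi i 0)%:C * coef_part (delta_mx i 0) m.
  apply/eqP; rewrite eq_complex Re_sum Im_sum /coef_part /=; apply/andP; split;
    apply/eqP; rewrite !mxE xiE; apply: eq_bigr => i _; rewrite !mxE; ring.
under [RHS]eq_bigr => i _ do rewrite mulrDr mulrCA.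
rewrite big_split /= -mulr_sumr -coefE freqE; congr (_ + _ * _).
apply/eqP; rewrite eq_complex Re_sum Im_sum /=; apply/andP; split; apply/eqP.
  by rewrite big1 // => i _; rewrite !(mulr0, mul0r) subr0.
by rewrite mulr_sumr -sumrN; apply: eq_bigr => i _; ring.
Qed.

End Tangent.

(** * Fisher information as a weighted tangent energy *)

Section Fisher.
Variable R : realType.
Implicit Types (a : array) (L sigma : R).

Lemma leC_Re (x y : R[i]) : x <= y -> complex.Re x <= complex.Re y.
Proof. by rewrite lecE => /andP[]. Qed.

Lemma ReZ (x : R) (z : R[i]) : complex.Re (x%:C * z) = x * complex.Re z.
Proof. by case: z => u v; simpc. Qed.

Section Fixed.
Variables (a : array) (K : nat) (Rs : 'M[R[i]]_(num_tx a)) (L sigma : R).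
Variables (omega : 'cV[R]_K) (beta : 'cV[R[i]]_K).

Let Q := Rs^T *t (1%:M : 'M[R[i]]_(num_rx a)).
Let F := fisher Rs L sigma omega beta.
Let T := tangent a omega beta.
Let gain := 2 * L / sigma ^+ 2.

Lemma fisherE i k :
  F i k = gain * complex.Re (((T (delta_mx i 0))^t* *m Q *m T (delta_mx k 0)) 0 0).
Proof. by rewrite mxE !partial_tangent. Qed.

(** Bilinear expansion through [tangent_sum]; the coordinates of [xi] are real and so pass through
    [complex.Re]. *)
Lemma fisher_qform (xi : 'cV[R]_(K + (K + K))) :
  qform F xi = gain * complex.Re (((T xi)^t* *m Q *m T xi) 0 0).
Proof.
rewrite /qform mxE /T (tangent_sum a omega beta xi) -/T.
set V := (X in (_ *m _ *m X)).
have -> : V^t* = \sum_i (xi i 0)%:C *: (T (delta_mx i 0))^t*.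
  rewrite /V linear_sum /= [LHS]raddf_sum /=; apply: eq_bigr => i _.
  by apply/matrixP => u v; rewrite !mxE conjC_conjc [LHS](rmorphM (@conjc R)) /= oppr0.
rewrite /V mulmx_sumr summxE Re_sum mulr_sumr; apply: eq_bigr => k _.
rewrite -scalemxAr [in RHS]mxE ReZ !mulmx_suml summxE Re_sum.
rewrite [in LHS]mxE mulr_suml !mulr_sumr.
apply: eq_bigr => i _.
rewrite -!scalemxAl [in RHS]mxE ReZ fisherE !mxE; ring.
Qed.

Hypothesis Rs_herm : Rs \is hermsymmx.

(** Swapping the two tangents conjugates their Hermitian product and leaves its real part
    unchanged. *)
Lemma fisher_sym : F^T = F.
Proof.
apply/matrixP => i k; rewrite mxE !fisherE; congr (_ * _).
set u := T _; set v := T _.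
have -> : u^t* *m Q *m v = (v^t* *m Q *m u)^t*.
  have Qh : Q^t* = Q := tens1_hermitian _ Rs_herm.
  by rewrite !trmx_mul !map_mxM /= Qh trmxCK mulmxA.
by rewrite !mxE; case: (\sum_j _).
Qed.

Variables (c1 c2 : R).
Hypothesis Rs_spec : spectrum_in Rs c1 c2.
Hypothesis gain_ge0 : 0 <= gain.

Lemma fisher_qform_ge (xi : 'cV[R]_(K + (K + K))) (x : R) : 0 <= c1 ->
  x%:C <= \sum_j `|T xi j 0| ^+ 2 -> gain * (c1 * x) <= qform F xi.
Proof.
move=> c1_ge0 xT; rewrite fisher_qform ler_wpM2l //.
have /andP[+ _] := tens1_bounds (T xi) Rs_herm Rs_spec.
move=> /leC_Re; rewrite ReZ; apply: le_trans.
by rewrite ler_wpM2l //; have /leC_Re := xT.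
Qed.

Lemma fisher_diag_le i (x : R) : 0 <= c2 ->
  \sum_j `|T (delta_mx i 0) j 0| ^+ 2 <= x%:C -> F i i <= gain * (c2 * x).
Proof.
move=> c2_ge0 xT; rewrite fisherE ler_wpM2l //.
have /andP[_ +] := tens1_bounds (T (delta_mx i 0)) Rs_herm Rs_spec.
move=> /leC_Re; rewrite ReZ => H; apply: le_trans H _.
by rewrite ler_wpM2l //; have /leC_Re := xT.
Qed.

End Fixed.
End Fisher.

(** * Upper and lower bounds on the tangent energy *)

Section Energy.
Variable R : realType.

Lemma norm_cis (x : R) : `|cis x| = 1.
Proof. by rewrite normc_def /= cos2Dsin2 sqrtr1. Qed.

Lemma cisX (x : R) (n : nat) : cis (n%:R * x) = cis x ^+ n.
Proof.
elim: n => [|n IH]; first by rewrite mul0r /cis cos0 sin0.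
by rewrite exprS -IH -natr1 mulrDl mul1r addrC cisD.
Qed.

(** Chord length on the unit circle; it converts the sine condition on the targets into a gap
    between nodes. *)
Lemma dist_cis (x y : R) : `|cis x - cis y| = (2 * `|sin ((x - y) / 2)|)%:C.
Proof.
rewrite normc_def; congr (_%:C).
have -> : 2 * `|sin ((x - y) / 2)| = `|2 * sin ((x - y) / 2)| by rewrite normrM ger0_norm.
rewrite -sqrtr_sqr; congr Num.sqrt.
have -> : (2 * sin ((x - y) / 2)) ^+ 2 = 2 * (1 - cos (x - y)).
  rewrite [in RHS](_ : x - y = (x - y) / 2 *+ 2); last by rewrite -mulr_natr mulfVK.
  rewrite cos_mulr2n cos2sin2; ring.
rewrite cosB /= -(cos2Dsin2 x).
have := cos2Dsin2 y; have := cos2Dsin2 x.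
move: (cos x) (sin x) (cos y) (sin y) => a b c d ab cd.
have -> : (a - c) ^+ 2 + (b - d) ^+ 2 =
  (a ^+ 2 + b ^+ 2) + (c ^+ 2 + d ^+ 2) - 2 * (a * c + b * d) by ring.
rewrite ab cd; ring.
Qed.

Lemma conjc_cisD (x y : R) : conjc (cis (x + y)) = conjc (cis x) * conjc (cis y).
Proof. by rewrite cisD [LHS](rmorphM (@conjc R)). Qed.

Lemma conjc_cisX (x : R) (n : nat) : conjc (cis (n%:R * x)) = conjc (cis x) ^+ n.
Proof. by rewrite cisX [LHS](rmorphXn (@conjc R)). Qed.

Lemma sqr_modulus_gt0 (z : R[i]) : z != 0 -> 0 < complex.Re z ^+ 2 + complex.Im z ^+ 2.
Proof. by move=> z0; rewrite -ltcR add_Re2_Im2 exprn_gt0 // normr_gt0. Qed.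

Section Fixed.
Variables (a : array) (K : nat) (omega : 'cV[R]_K) (beta : 'cV[R[i]]_K).
Let Nt := num_tx a.
Let Nr := num_rx a.
Let T := tangent a omega beta.

(** For a fixed receive element [k] the tangent is an exponential sum in the transmit index: [y] is
    the node, [W] the unimodular receive phase, [A] the slope and [B] the offset. Nuisance
    coordinates enter only [B]. *)
Let y m := conjc (cis ((tx_step a)%:R * omega m 0)).
Let W (k : nat) m := conjc (cis ((k * rx_step a)%:R * omega m 0)).
Let A (xi : 'cV[R]_(K + (K + K))) k m :=
  beta m 0 * (0 -i* ((tx_step a)%:R * freq_part xi m)) * W k m.
Let B (xi : 'cV[R]_(K + (K + K))) (k : nat) m :=
  (coef_part xi m + beta m 0 * (0 -i* ((k * rx_step a)%:R * freq_part xi m))) * W k m.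

Let y1 m : `|y m| = 1.
Proof. by rewrite normcJ norm_cis. Qed.

Let W1 k m : `|W k m| = 1.
Proof. by rewrite normcJ norm_cis. Qed.

Let tangent_slice xi (i : 'I_Nt) (k : 'I_Nr) :
  T xi (mxtens_index (i, k)) 0 = \sum_m (A xi k m * i%:R + B xi k m) * y m ^+ i.
Proof.
have xE : position R (mxtens_index (i, k)) =
    i%:R * (tx_step a)%:R + (k * rx_step a)%:R.
  by rewrite /position mxtens_indexK natrM.
rewrite /T mxE; apply: eq_bigr => m _; rewrite xE.
rewrite [_ * omega m 0]mulrDl conjc_cisD -/(W k m).
rewrite -[_ * _ * omega m 0]mulrA conjc_cisX -/(y m).
have -> : 0 -i* (((i%:R * (tx_step a)%:R) + (k * rx_step a)%:R) * freq_part xi m) =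
  (0 -i* ((tx_step a)%:R * freq_part xi m)) * i%:R +
  (0 -i* ((k * rx_step a)%:R * freq_part xi m)) :> R[i].
  have -> : i%:R = (i%:R)%:C :> R[i] by rewrite [RHS]rmorph_nat.
  by simpc; congr (_ +i* _); ring.
rewrite /A /B; ring.
Qed.

(** The modulus does not depend on [k], so summing over receive elements yields a factor [Nr]. *)
Let norm_slope xi k m : `|A xi k m| ^+ 2 =
  ((complex.Re (beta m 0) ^+ 2 + complex.Im (beta m 0) ^+ 2) *
     (tx_step a)%:R ^+ 2 * freq_part xi m ^+ 2)%:C.
Proof.
rewrite /A !normrM W1 mulr1 exprMn -add_Re2_Im2 -[X in _ * X]add_Re2_Im2 -rmorphM /=.
congr (_%:C); ring.
Qed.

Let gap_y (delta : R) m n :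
  delta <= `|sin ((tx_step a)%:R * (omega m 0 - omega n 0) / 2)| ->
  2 * delta%:C <= `|y m - y n|.
Proof.
move=> H; have -> : y m - y n =
    conjc (cis ((tx_step a)%:R * omega m 0) - cis ((tx_step a)%:R * omega n 0)).
  by rewrite [RHS](rmorphB (@conjc R)).
rewrite normcJ dist_cis -mulrBr (_ : 2 = 2%:C); last by rewrite [RHS]rmorph_nat.
by rewrite -rmorphM lecR ler_wpM2l.
Qed.

Lemma tangent_energy_ge (delta : R) (h : nat) m0 xi : 0 <= delta ->
  (forall m, m != m0 ->
     delta <= `|sin ((tx_step a)%:R * (omega m0 0 - omega m 0) / 2)|) ->
  (h + h + 2 * K.-1 <= Nt)%N ->
  (delta ^+ (4 * K.-1) * h%:R ^+ 3 * Nr%:R * (tx_step a)%:R ^+ 2 / 2 *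
    (complex.Re (beta m0 0) ^+ 2 + complex.Im (beta m0 0) ^+ 2) *
    freq_part xi m0 ^+ 2)%:C <= \sum_j `|T xi j 0| ^+ 2.
Proof.
move=> d0 gap hN.
have d0C : 0 <= delta%:C by rewrite lecR.
have gapC m : m != m0 -> 2 * delta%:C <= `|y m0 - y m| by move=> /gap/gap_y.
have H k := exp_sum_energy_ge y1 d0C gapC (A xi k) (B xi k) hN.
rewrite sum_mxtens -(ler_pM2l (_ : 0 < 2)) // mulr_sumr.
apply: (@le_trans _ _
  (\sum_(k < Nr) `|A xi k m0| ^+ 2 * delta%:C ^+ (4 * K.-1) * h%:R ^+ 3)).
  under eq_bigr do rewrite norm_slope.
  rewrite sumr_const card_ord -[(_ * _) *+ Nr]mulr_natr.
  have nC (n : nat) : n%:R = (n%:R)%:C :> R[i] by rewrite [RHS]rmorph_nat.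
  rewrite (nC h) (nC Nr) (nC 2%N) -!(rmorphXn, rmorphM) /= lecR le_eqVlt; apply/orP; left.
  by apply/eqP; field.
apply: ler_sum => k _; apply: le_trans (H k) _; rewrite ler_pM2l //.
by under [in leRHS]eq_bigr do rewrite tangent_slice.
Qed.

(** Local identifiability in two stages: [tangent_energy_ge] with [h = 1] forces the frequency
    coordinates to vanish; the slopes are then zero and [exp_sum_eq0], at receive element 0, removes
    the coefficients. *)
Lemma tangent_energy_eq0 (delta : R) xi : 0 < delta ->
  (forall m n, m != n ->
     delta <= `|sin ((tx_step a)%:R * (omega m 0 - omega n 0) / 2)|) ->
  (2 * K.-1 + 2 <= Nt)%N -> (0 < Nr)%N -> (0 < tx_step a)%N ->
  (forall m, beta m 0 != 0) ->
  \sum_j `|T xi j 0| ^+ 2 = 0 -> xi = 0.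
Proof.
move=> d0 gap KN Nr0 st0 b0 E0.
have T0 j : T xi j 0 = 0.
  have /psumr_eq0P := E0 => /(_ (fun i _ => exprn_ge0 _ (normr_ge0 _))) /(_ j isT).
  by move=> /eqP; rewrite expf_eq0 normr_eq0 => /andP[_ /eqP].
have f0 m : freq_part xi m = 0.
  have gap_m n : n != m -> delta <= `|sin ((tx_step a)%:R * (omega m 0 - omega n 0) / 2)|.
    by move=> nm; apply: gap; rewrite eq_sym.
  have hN : (1 + 1 + 2 * K.-1 <= Nt)%N by rewrite addnC.
  have := tangent_energy_ge xi (ltW d0) gap_m hN.
  rewrite E0 (_ : 0 = 0%:C) // lecR; apply: contraTeq => fm0; rewrite -ltNge.
  have := sqr_modulus_gt0 (b0 m) => bm.
  have f2 : 0 < freq_part xi m ^+ 2 by rewrite exprn_even_gt0.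
  rewrite mulr_gt0 // mulr_gt0 // divr_gt0 // mulr_gt0 ?exprn_gt0 ?ltr0n //.
  by rewrite !mulr_gt0 ?exprn_gt0 ?ltr0n.
have c0 m : coef_part xi m = 0.
  have A0 n : A xi 0 n = 0 by rewrite /A f0 mulr0 oppr0 mulr0 mul0r.
  have B0 : B xi 0 m = 0.
    apply: (@exp_sum_eq0 _ _ y delta%:C m y1 _ _ (A xi 0) _ Nt) => //.
    - by rewrite lecR ltW.
    - by move=> n nm; apply/gap_y/gap; rewrite eq_sym.
    - by rewrite (_ : 0 = 0%:C) // (inj_eq (@complexI _)) gt_eqF.
    - by lia.
    - by move=> i iN; rewrite -(tangent_slice xi (Ordinal iN) (Ordinal Nr0)) T0.
  move/eqP: B0; rewrite /B f0 mulr0 oppr0 mulr0 addr0 mulf_eq0.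
  by rewrite -[W 0 m == 0]normr_eq0 W1 oner_eq0 orbF => /eqP.
rewrite -[xi]vsubmxK -[dsubmx xi]vsubmxK.
have -> : usubmx xi = 0 by apply/colP => m; rewrite [RHS]mxE; exact: f0.
have -> : usubmx (dsubmx xi) = 0.
  by apply/colP => m; rewrite [RHS]mxE; have /(congr1 (@complex.Re R)) := c0 m.
have -> : dsubmx (dsubmx xi) = 0.
  by apply/colP => m; rewrite [RHS]mxE; have /(congr1 (@complex.Im R)) := c0 m.
by rewrite !col_mx0.
Qed.

Lemma position_ge0 (j : 'I_(Nt * Nr)) : 0 <= position R j.
Proof. by rewrite addr_ge0. Qed.

Lemma position_le (j : 'I_(Nt * Nr)) :
  position R j <= (Nt * tx_step a + Nr * rx_step a)%:R.
Proof.
by rewrite /position -natrD ler_nat leq_add // leq_mul2r ltnW ?orbT.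
Qed.

(** Crude bound: every virtual element is charged as if it sat at the far end of the virtual
    aperture. *)
Lemma tangent_energy_le m :
  \sum_j `|T (delta_mx (lshift (K + K) m) 0) j 0| ^+ 2 <=
  ((Nt * Nr)%:R * (Nt * tx_step a + Nr * rx_step a)%:R ^+ 2 *
    (complex.Re (beta m 0) ^+ 2 + complex.Im (beta m 0) ^+ 2))%:C.
Proof.
set e := delta_mx _ _; set X := (_ + _)%:R.
have ce n : coef_part e n = 0.
  by rewrite /coef_part /e !mxE !eq_rlshift.
have fe n : freq_part e n = (n == m)%:R.
  by rewrite /freq_part !mxE (inj_eq (@lshift_inj _ _)) andbT.
have TE j : T e j 0 =
    beta m 0 * (0 -i* position R j) * conjc (cis (position R j * omega m 0)).
  rewrite mxE (bigD1 m) //= big1 => [|n /negPf nm]; rewrite ce fe ?eqxx ?nm.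
    by rewrite add0r addr0 mulr1.
  by rewrite mulr0 oppr0 mulr0 add0r mul0r.
apply: (@le_trans _ _ (\sum_(j < Nt * Nr)
  ((complex.Re (beta m 0) ^+ 2 + complex.Im (beta m 0) ^+ 2) * X ^+ 2)%:C)).
  apply: ler_sum => j _; rewrite TE !normrM normcJ norm_cis mulr1 exprMn.
  rewrite -add_Re2_Im2 -[X in _ * X <= _]add_Re2_Im2 -rmorphM lecR /=.
  rewrite ler_wpM2l ?addr_ge0 ?sqr_ge0 // expr0n add0r sqrrN.
  by rewrite lerXn2r ?nnegrE ?position_ge0 ?position_le.
rewrite sumr_const card_ord -rmorphMn lecR /= -mulr_natl le_eqVlt.
by apply/orP; left; apply/eqP; ring.
Qed.

End Fixed.
End Energy.

(** * Two-sided bounds on the diagonal of the CRB *)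

Section CRB.
Variable R : realType.
Variables (a : array) (K : nat) (Rs : 'M[R[i]]_(num_tx a)) (L sigma : R).
Variables (omega : 'cV[R]_K) (beta : 'cV[R[i]]_K) (c1 c2 delta : R).
Hypothesis sigma_gt0 : 0 < sigma.
Hypothesis L_gt0 : 0 < L.
Hypothesis c1_gt0 : 0 < c1.
Hypothesis c12 : c1 <= c2.
Hypothesis beta_neq0 : forall m, beta m 0 != 0.
Hypothesis Rs_herm : Rs \is hermsymmx.
Hypothesis Rs_spec : spectrum_in Rs c1 c2.
Hypothesis delta_gt0 : 0 < delta.
Hypothesis gap : forall m n, m != n ->
  delta <= `|sin ((tx_step a)%:R * (omega m 0 - omega n 0) / 2)|.
Hypothesis many_tx : (2 * K.-1 + 2 <= num_tx a)%N.
Hypothesis rx_gt0 : (0 < num_rx a)%N.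
Hypothesis step_gt0 : (0 < tx_step a)%N.

Let F := fisher Rs L sigma omega beta.
Let T := tangent a omega beta.
Let gain := 2 * L / sigma ^+ 2.
Let B m := complex.Re (beta m 0) ^+ 2 + complex.Im (beta m 0) ^+ 2.

Let gain_gt0 : 0 < gain.
Proof. by rewrite divr_gt0 ?exprn_gt0 ?mulr_gt0. Qed.

Lemma fisher_posdef xi : xi != 0 -> 0 < qform F xi.
Proof.
move=> xi0; set E := \sum_j `|T xi j 0| ^+ 2.
have E0 : 0 <= E by apply: sumr_ge0 => j _; rewrite exprn_ge0.
have EC : (complex.Re E)%:C = E by rewrite RRe_real // ger0_real.
have Egt0 : 0 < complex.Re E.
  rewrite -ltcR EC lt_def E0 andbT; apply: contraNneq xi0 => Eeq.
  by rewrite (tangent_energy_eq0 delta_gt0 gap many_tx rx_gt0 step_gt0 beta_neq0 Eeq).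
have ET : (complex.Re E)%:C <= \sum_j `|T xi j 0| ^+ 2 by rewrite EC.
apply: lt_le_trans (fisher_qform_ge Rs_herm Rs_spec (ltW gain_gt0) (ltW c1_gt0) ET).
by rewrite (mulr_gt0 gain_gt0) // mulr_gt0.
Qed.

Lemma crb_diag_gt0 m : 0 < crb_omega Rs L sigma omega beta m m.
Proof. exact: (schur_inv_gt0 fisher_posdef). Qed.

(** The inverse of a diagonal Fisher entry is the bound with all other parameters known, and
    [tangent_energy_le] controls that entry. *)
Lemma crb_diag_ge m :
  (gain * (c2 * ((num_tx a * num_rx a)%:R *
     (num_tx a * tx_step a + num_rx a * rx_step a)%:R ^+ 2 * B m)))^-1
  <= crb_omega Rs L sigma omega beta m m.
Proof.
apply: le_trans (schur_inv_ge fisher_posdef m (fisher_sym _ _ _ _ Rs_herm)).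
have c2_ge0 : 0 <= c2 by apply: ltW; apply: lt_le_trans c12.
have Fm := fisher_diag_le Rs_herm Rs_spec (ltW gain_gt0) c2_ge0
  (tangent_energy_le a omega beta m).
have Fgt0 : 0 < F (lshift (K + K) m) (lshift (K + K) m).
  by rewrite -qform_delta fisher_posdef // delta_neq0.
by rewrite lef_pV2 ?posrE // (lt_le_trans Fgt0).
Qed.

(** The estimate [tangent_energy_ge] is uniform in the other coordinates, as [schur_inv_le]
    requires. *)
Lemma crb_diag_le m (h : nat) : (0 < h)%N -> (h + h + 2 * K.-1 <= num_tx a)%N ->
  crb_omega Rs L sigma omega beta m m <=
  (gain * (c1 * (delta ^+ (4 * K.-1) * h%:R ^+ 3 * (num_rx a)%:R *
     (tx_step a)%:R ^+ 2 / 2 * B m)))^-1.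
Proof.
move=> h0 hN; apply: (schur_inv_le fisher_posdef) => [|xi].
  have Bm := sqr_modulus_gt0 (beta_neq0 m).
  rewrite (mulr_gt0 gain_gt0) // (mulr_gt0 c1_gt0) // mulr_gt0 // divr_gt0 //.
  by rewrite !(mulr_gt0, exprn_gt0) ?ltr0n.
have gap_m n : n != m -> delta <= `|sin ((tx_step a)%:R * (omega m 0 - omega n 0) / 2)|.
  by move=> nm; apply: gap; rewrite eq_sym.
have := fisher_qform_ge Rs_herm Rs_spec (ltW gain_gt0) (ltW c1_gt0)
  (tangent_energy_ge beta xi (ltW delta_gt0) gap_m hN).
by apply: le_trans; rewrite /freq_part mxE -!mulrA.
Qed.

End CRB.

(** * Comparison of the two arrays at equal CRB *)

(** Clears denominators in the trace comparison: [sigma] cancels, and 8 is the 4 from [(2 * P) ^+ 2]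
    times the 2 from the halved ULA energy. *)
Lemma snapshot_ratio_bound (R : realFieldType) (sigma Lc Lu c1 c2 D S b P h N2 : R) :
  0 < sigma -> 0 < Lc -> 0 < Lu -> 0 < c1 -> 0 < c2 -> 0 < D -> 0 < b ->
  0 < P -> 0 < h -> 0 < N2 ->
  (2 * Lc / sigma ^+ 2 * (c2 * (P * (2 * P) ^+ 2 * b)))^-1 <=
    (2 * Lu / sigma ^+ 2 * (c1 * (D * h ^+ 3 * N2 / 2)))^-1 * S ->
  Lu * (c1 * D * (h ^+ 3 * N2)) <= Lc * (8 * S * c2 * b * P ^+ 3).
Proof.
move=> s0 Lc0 Lu0 c10 c20 D0 b0 P0 h0 N20 H.
have g0 L : 0 < L -> 0 < 2 * L / sigma ^+ 2.
  by move=> L0; rewrite divr_gt0 ?exprn_gt0 // mulr_gt0.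
have x0 : 0 < 2 * Lc / sigma ^+ 2 * (c2 * (P * (2 * P) ^+ 2 * b)).
  by rewrite mulr_gt0 ?g0 // (mulr_gt0 c20) // mulr_gt0 // mulr_gt0 // exprn_gt0 // mulr_gt0.
have y0 : 0 < 2 * Lu / sigma ^+ 2 * (c1 * (D * h ^+ 3 * N2 / 2)).
  rewrite mulr_gt0 ?g0 // (mulr_gt0 c10) // divr_gt0 // mulr_gt0 // mulr_gt0 //.
  exact: exprn_gt0.
move: H; rewrite -(ler_pM2l x0) mulfV ?gt_eqF // -(ler_pM2l y0) mulr1.
rewrite [X in _ <= X -> _]mulrCA mulVKf ?gt_eqF // -(ler_pM2r (exprn_gt0 2 s0)).
have -> : 2 * Lu / sigma ^+ 2 * (c1 * (D * h ^+ 3 * N2 / 2)) * sigma ^+ 2 =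
  Lu * (c1 * D * (h ^+ 3 * N2)) by field; rewrite gt_eqF.
congr (_ <= _); field; rewrite gt_eqF //.
Qed.

(** Both [h] and [N2] are at least of order [P], so [h ^+ 3 * N2] is of order [P ^+ 4] and beats
    [P ^+ 3]. The constant is [2 ^+ 13 = 16 ^+ 3 * 2]. *)
Lemma aperture_gain_bound (R : realFieldType) (w V lo hi P X N1 N2 h : R) :
  0 < w -> 0 < lo -> hi < 1 -> 0 < P -> P <= 2 * X -> lo * X <= N1 ->
  (1 - hi) * X <= N2 -> N1 <= 8 * h ->
  2 ^+ 13 * V < w * lo ^+ 3 * (1 - hi) * P -> V * P ^+ 3 < w * (h ^+ 3 * N2).
Proof.
move=> w0 lo0 hi1 P0 PX loX hiX N1h.
have hi0 : 0 < 1 - hi by lra.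
have loP : lo * P <= lo * (2 * X) by rewrite ler_pM2l.
have hiP : (1 - hi) * P <= (1 - hi) * (2 * X) by rewrite ler_pM2l.
have hP : lo * P / 16 <= h by lra.
have N2P : (1 - hi) * P / 2 <= N2 by lra.
have q0 : 0 < lo * P / 16 by rewrite divr_gt0 ?mulr_gt0.
move=> H.
apply: (@lt_le_trans _ _ (w * ((lo * P / 16) ^+ 3 * ((1 - hi) * P / 2)))).
  have -> : w * ((lo * P / 16) ^+ 3 * ((1 - hi) * P / 2)) =
     (w * lo ^+ 3 * (1 - hi) * P) / 2 ^+ 13 * P ^+ 3 by field.
  by rewrite ltr_pM2r ?exprn_gt0 // ltr_pdivlMr ?exprn_gt0 // mulrC.
rewrite ler_pM2l // ler_pM ?exprn_ge0 ?(ltW q0) //.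
  by rewrite divr_ge0 ?mulr_ge0 ?ltW.
by rewrite lerXn2r ?nnegrE ?(ltW q0) // (le_trans (ltW q0)).
Qed.

Lemma addn_pred_leq_mul (m n : nat) : (0 < m)%N -> (0 < n)%N -> (m + n - 1 <= m * n)%N.
Proof. by case: m n => [|m] [|n] // _ _; rewrite mulSn mulnS; lia. Qed.

(** The common aperture is at least [(m - 1) * n], hence at least half of [m * n] as [m] is at least
    2. *)
Lemma ula_size_ge (m n n1 n2 : nat) : (1 < m)%N -> (0 < n1)%N ->
  ula_aperture (n1 + n2 - 1) = cpa_aperture m n -> (m * n <= 2 * (n1 + n2))%N.
Proof.
rewrite /ula_aperture /cpa_aperture => m1 n10 E.
have := leq_maxl ((m - 1) * n) ((n - 1) * m); rewrite -E mulnBl mul1n.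
have : (2 * n <= m * n)%N by rewrite leq_mul2r m1 orbT.
move: (m * n)%N => P; lia.
Qed.

Theorem theorem3 (R : realType)
  (* targets and noise *)
  (K : nat) (theta : 'I_K -> R) (omega : 'cV[R]_K) (beta : 'cV[R[i]]_K)
  (sigma : R)
  (HK : (1 <= K)%N)
  (Homega : forall m, omega m 0 = pi * sin (theta m))
  (Hbeta : forall m, beta m 0 != 0)
  (Hsigma : 0 < sigma)
  (* family of co-prime arrays *)
  (M1 M2 Ms : nat -> nat) (rho : nat -> R) (rho_lo rho_hi : R)
  (HM1 : forall k, (0 < M1 k)%N)
  (HM2 : forall k, (0 < M2 k)%N)
  (Hcoprime : forall k, coprime (M1 k) (M2 k))
  (HMs : forall k, Ms k = (M1 k + M2 k - 1)%N)
  (HM1rho : forall k, (M1 k)%:R = rho k * (Ms k + 1)%:R)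
  (HM2rho : forall k, (M2 k)%:R = (1 - rho k) * (Ms k + 1)%:R)
  (Hrho_lo : 0 < rho_lo)
  (Hrho_hi : rho_hi < 1)
  (Hrho : forall k, rho_lo <= rho k <= rho_hi)
  (HMsoo : Ms k @[k --> \oo] --> \oo)
  (* same-aperture partitioned ULAs *)
  (MU N1 N2 : nat -> nat) (tau_lo tau_hi : R)
  (HN1 : forall k, (0 < N1 k)%N)
  (HN2 : forall k, (0 < N2 k)%N)
  (HMU : forall k, (N1 k + N2 k - 1)%N = MU k)
  (Htau_lo : 0 < tau_lo)
  (Htau_hi : tau_hi < 1)
  (Htau : forall k, tau_lo <= (N1 k)%:R / (MU k + 1)%:R <= tau_hi)
  (Haperture : forall k, ula_aperture (MU k) = cpa_aperture (M1 k) (M2 k))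
  (* nondegenerate placement, void when K = 1 *)
  (delta : R)
  (Hdelta : 0 < delta < 1)
  (Hcpa_nondeg : forall k (m n : 'I_K), m != n ->
     delta <= `|sin ((M1 k)%:R * (omega m 0 - omega n 0) / 2)| /\
     delta <= `|sin ((M2 k)%:R * (omega m 0 - omega n 0) / 2)|)
  (Hula_nondeg : forall m n : 'I_K, m != n ->
     delta <= `|sin ((omega m 0 - omega n 0) / 2)|)
  (* transmit covariances *)
  (p c1 c2 : R)
  (Rcpa : forall k, 'M[R[i]]_(num_tx (cpa (M1 k) (M2 k))))
  (Rula : forall k, 'M[R[i]]_(num_tx (ula (N1 k) (N2 k))))
  (Hp : 0 < p)
  (Hc1 : 0 < c1)
  (Hc12 : c1 <= c2)
  (HRcpa : forall k, admissible_covariance p c1 c2 (Rcpa k))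
  (HRula : forall k, admissible_covariance p c1 c2 (Rula k))
  (* snapshots *)
  (Lcpa Lula : nat -> R)
  (HLcpa : forall k, 0 < Lcpa k)
  (HLula : forall k, 0 < Lula k) :
  exists M0 : nat, forall k, (M0 <= Ms k)%N ->
    \tr (crb_omega (Rcpa k) (Lcpa k) sigma omega beta) =
      \tr (crb_omega (Rula k) (Lula k) sigma omega beta) ->
    Lcpa k > Lula k.
Proof.
have [delta_gt0 _] := andP Hdelta.
(* A single target suffices to bound the CPA trace from below. *)
pose m1 := Ordinal HK.
pose B m := complex.Re (beta m 0) ^+ 2 + complex.Im (beta m 0) ^+ 2.
have B_gt0 m : 0 < B m by exact: sqr_modulus_gt0.
pose S := \sum_m (B m)^-1.
have S_ge0 : 0 <= S by apply: sumr_ge0 => m _; rewrite invr_ge0 ltW.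
have c2_gt0 : 0 < c2 by exact: lt_le_trans Hc12.
pose D := delta ^+ (4 * K.-1).
have D_gt0 : 0 < D by rewrite exprn_gt0.
pose V := 8 * S * c2 * B m1.
pose w := c1 * D * tau_lo ^+ 3 * (1 - tau_hi).
have w_gt0 : 0 < w by rewrite !mulr_gt0 ?exprn_gt0 ?subr_gt0.
have V_ge0 : 0 <= V by rewrite !mulr_ge0 // ltW.
(* Thresholds on [Ms k]: [G1] makes [P] large enough for [aperture_gain_bound], [G2] gives
   [4 * K + 6 <= N1 k] and [G3] gives [2 * K + 2 <= M1 k]. *)
pose G1 := 2 ^+ 13 * V / w.
pose G2 := 2 * (4 * K + 6)%:R / tau_lo.
pose G3 := (2 * K + 2)%:R / rho_lo.
have G1_ge0 : 0 <= G1 by rewrite divr_ge0 ?(ltW w_gt0) // mulr_ge0 ?exprn_ge0.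
have G2_ge0 : 0 <= G2 by rewrite divr_ge0 ?mulr_ge0 // ltW.
have G3_ge0 : 0 <= G3 by rewrite divr_ge0 // ltW.
exists (Num.bound G1 + Num.bound G2 + Num.bound G3)%N => k Mk trE.
have large G n : 0 <= G -> (Num.bound G <= n)%N -> (n <= Ms k)%N -> G < (Ms k)%:R.
  move=> G0 Gn nM; apply: lt_le_trans (archi_boundP G0) _.
  by rewrite ler_nat (leq_trans Gn).
have MG1 : G1 < (Ms k)%:R by apply: large Mk => //; rewrite -addnA leq_addr.
have MG2 : G2 < (Ms k)%:R by apply: large Mk => //; rewrite addnAC leq_addl.
have MG3 : G3 < (Ms k)%:R by apply: large Mk => //; rewrite leq_addl.
set P := (M1 k * M2 k)%N.
have MsP : (Ms k <= P)%N by rewrite HMs addn_pred_leq_mul.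
have M1_large : (2 * K + 2 <= M1 k)%N.
  rewrite -(ler_nat R) HM1rho natrD.
  move: MG3; rewrite /G3 ltr_pdivrMr // => MG3.
  have /andP[lo _] := Hrho k.
  have : rho_lo * ((Ms k)%:R + 1) <= rho k * ((Ms k)%:R + 1) by rewrite ler_wpM2r.
  move: MG3; rewrite mulrDr mulr1 natrD => MG3; lra.
have M1_gt1 : (1 < M1 k)%N by move: M1_large; clear; lia.
have PX : (P <= 2 * (N1 k + N2 k))%N.
  by apply: ula_size_ge => //; rewrite HMU Haperture.
have XE : (MU k + 1)%N = (N1 k + N2 k)%N by rewrite -HMU subnK ?addn_gt0 ?HN1.
have X_gt0 : 0 < (N1 k + N2 k)%:R :> R by rewrite ltr0n addn_gt0 HN1.
have [N1_lo N1_hi] : tau_lo * (N1 k + N2 k)%:R <= (N1 k)%:R /\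
    (N1 k)%:R <= tau_hi * (N1 k + N2 k)%:R.
  by have := Htau k; rewrite XE ler_pdivlMr // ler_pdivrMr // => /andP.
have PX_R : P%:R <= 2 * (N1 k + N2 k)%:R :> R by rewrite -natrM ler_nat.
have MsP_R : (Ms k)%:R <= P%:R :> R by rewrite ler_nat.
have N1_large : (4 * K + 6 <= N1 k)%N.
  rewrite -(ler_nat R); apply: le_trans N1_lo.
  move: MG2; rewrite /G2 ltr_pdivrMr // => MG2.
  have : tau_lo * (Ms k)%:R <= tau_lo * (2 * (N1 k + N2 k)%:R).
    by rewrite ler_pM2l // (le_trans MsP_R).
  lra.
(* A quarter of [N1 k] leaves room for the [2 * K.-1] spare indices, while [N1 k <= 8 * h] survives
   the rounding. *)
pose h := (N1 k %/ 4)%N.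
have h_gt0 : (0 < h)%N by rewrite /h; move: N1_large; clear; lia.
have hN : (h + h + 2 * K.-1 <= N1 k)%N.
  by rewrite /h; move: N1_large; clear; lia.
have [Rc_herm _] : posdefmx (Rcpa k) by case: (HRcpa k).
have [Ru_herm _] : posdefmx (Rula k) by case: (HRula k).
have Rc_spec : spectrum_in (Rcpa k) c1 c2 by case: (HRcpa k).
have Ru_spec : spectrum_in (Rula k) c1 c2 by case: (HRula k).
have gap_c m n : m != n ->
    delta <= `|sin ((tx_step (cpa (M1 k) (M2 k)))%:R * (omega m 0 - omega n 0) / 2)|.
  by move=> /(Hcpa_nondeg k) [].
have gap_u m n : m != n ->
    delta <= `|sin ((tx_step (ula (N1 k) (N2 k)))%:R * (omega m 0 - omega n 0) / 2)|.
  by move=> /Hula_nondeg; rewrite /= mul1r.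
have many_c : (2 * K.-1 + 2 <= M1 k)%N by move: M1_large; clear; lia.
have many_u : (2 * K.-1 + 2 <= N1 k)%N by move: N1_large; clear; lia.
(* For the CPA both [num_rx] and [tx_step] equal [M2 k], hence the repeated [HM2 k]. *)
have crb_c := crb_diag_ge Hsigma (HLcpa k) Hc1 Hc12 Hbeta Rc_herm Rc_spec delta_gt0
  gap_c many_c (HM2 k) (HM2 k) m1.
have crb_c0 := crb_diag_gt0 Hsigma (HLcpa k) Hc1 Hbeta Rc_herm Rc_spec delta_gt0
  gap_c many_c (HM2 k) (HM2 k).
have crb_u m := crb_diag_le Hsigma (HLula k) Hc1 Hbeta Ru_herm Ru_spec delta_gt0
  gap_u many_u (HN2 k) (ltn0Sn 0) m h_gt0 hN.
have tr_c : crb_omega (Rcpa k) (Lcpa k) sigma omega beta m1 m1 <=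
    \tr (crb_omega (Rcpa k) (Lcpa k) sigma omega beta).
  by rewrite /mxtrace (bigD1 m1) //= lerDl sumr_ge0 // => m _; exact: ltW.
have tr_u : \tr (crb_omega (Rula k) (Lula k) sigma omega beta) <=
    (2 * Lula k / sigma ^+ 2 * (c1 * (D * h%:R ^+ 3 * (N2 k)%:R / 2)))^-1 * S.
  rewrite /mxtrace /S mulr_sumr; apply: ler_sum => m _.
  apply: le_trans (crb_u m) _; rewrite /= expr1n mulr1 -invfM.
  by rewrite -/D -/(B m) !mulrA.
have P_gt0 : 0 < P%:R :> R by rewrite ltr0n muln_gt0 HM1 HM2.
have h_gt0R : 0 < h%:R :> R by rewrite ltr0n.
have N2_gt0 : 0 < (N2 k)%:R :> R by rewrite ltr0n.
have ratio : Lula k * (c1 * D * (h%:R ^+ 3 * (N2 k)%:R)) <= Lcpa k * (V * P%:R ^+ 3).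
  apply: (snapshot_ratio_bound (sigma := sigma)) => //.
  apply: le_trans tr_u; rewrite -trE; apply: le_trans tr_c.
  (* The two CPA products [num_tx * tx_step] and [num_rx * rx_step] both equal [P], so their sum is
     [2 * P]. *)
  move: crb_c; rewrite /= -/(B m1) [(M2 k * M1 k)%N]mulnC -/P.
  by rewrite addnn -mul2n natrM.
have strict : V * P%:R ^+ 3 < c1 * D * (h%:R ^+ 3 * (N2 k)%:R).
  apply: (aperture_gain_bound (lo := tau_lo) (hi := tau_hi)
    (X := (N1 k + N2 k)%:R) (N1 := (N1 k)%:R)) => //.
  - by rewrite mulr_gt0.
  - by move: N1_hi; rewrite natrD; lra.
  - by rewrite -natrM ler_nat /h; move: N1_large; clear; lia.
  - rewrite -/w; move: MG1; rewrite /G1 ltr_pdivrMr // => MG1.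
    by apply: lt_le_trans MG1 _; rewrite mulrC ler_pM2l.
(* If [Lcpa k <= Lula k], then [strict] and [ratio] give [Lula k * (V * P%:R ^+ 3) < Lcpa k * (V *
   P%:R ^+ 3)], which contradicts [0 <= V]. *)
rewrite ltNge; apply/negP => LL.
have := lt_le_trans (_ : Lula k * (V * P%:R ^+ 3) < _) ratio.
rewrite ltr_pM2l // => /(_ strict); apply/negP; rewrite -leNgt.
by rewrite ler_wpM2r // mulr_ge0 ?exprn_ge0 ?mulr_ge0 // ltW.
Qed.
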